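(* Let $K$ be locally compact and discretely valued, with uniformiser $\pi$ and valuation ring $\mathcal O_K$. Let $g=\sum_i a_i|f_i|$ be a finite sum with $a_i>0$ and $f_i\in\mathcal O_K[x_1,\dots,x_n]$, regarded as a function $K^n\to\mathbb R$, and let $f=-g$. Suppose $x_*\in\mathcal O_K^n$ is a global minimum of $g$. Let $x_0,x_1,\dots$ be the sequence of iterates from running the polydisc-space deterministic optimistic optimisation (DOO) algorithm (described in the context) indefinitely. Then $(x_i)$ admits a subsequence that converges to a global minimum of $g$. In fact, any convergent subsequence of $(x_i)$ converges to a global minimum of $g$.
   Context: $K$ is a field with a non-trivial discrete valuation $\mathrm{val}$ (normalised so that $\mathrm{val}(K^\ast)=\mathbb Z$), complete and locally compact for the absolute value $|a|=\exp(-\mathrm{val}(a))$ (base fixed). $\mathcal S\subseteq\mathcal O_K$ is a fixed set of representatives of the residue classes modulo the maximal ideal. Search domain and cells: $\mathcal X=\mathcal O_K^n$. For each level $h\ge0$, the cells $X_{h,i}$ are the distinct subsets of $\mathcal X$ of the form $\{z\in K^n:\mathrm{val}(z_j-a_j)\ge h\ \forall j\}$ with $a\in\mathcal O_K^n$; there are $|\mathfrak K|^{nh}$ of them ($\mathfrak K$ the residue field), and $X_{0,0}=\mathcal X$. The children of a cell at level $h$ are the cells at level $h+1$ contained in it. Each cell $X_{h,i}$ has the canonical representative point $x_{h,i}=\sum_{j=0}^{h-1}c_j\pi^j\in X_{h,i}$ with $c_j\in\mathcal S^n$. Bounds: fix $q\in[1,\infty]$, let $L=\sum_i a_i$, $\delta(h)=L|\pi|^h\,\|(1,\dots,1)\|_{\ell^q}$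 (with $(1,\dots,1)\in\mathbb R^n$), and $b_{h,i}=f(x_{h,i})+\delta(h)$. Polydisc-space DOO: start with the tree $\mathcal T=\{X_{0,0}\}$. In each epoch, among the current leaves of $\mathcal T$ select one, $(h,i)$, maximising $b_{h,i}$, and add to $\mathcal T$ all children of $X_{h,i}$. After $N$ epochs the algorithm returns the iterate $x_N=x_{h,i}$ where $(h,i)$ maximises $f(x_{h,i})$ over all nodes of $\mathcal T$. *)

(* Defs.v *)
From HB Require Import structures.
From mathcomp Require Import all_boot all_order all_algebra.
From mathcomp Require Import all_classical all_reals all_analysis.
(* not imported: its notations clash with those of MathComp-Analysis *)
From mathcomp Require mpoly.

Set Implicit Arguments.
Unset Strict Implicit.
Unset Printing Implicit Defensive.

Import Order.TTheory GRing.Theory Num.Theory.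

Local Open Scope classical_set_scope.
Local Open Scope ring_scope.

(* A normalised discrete valuation together with the (arbitrary, fixed) base of
   its absolute value. The image axiom says val(K^* ) = Z; in particular the
   valuation is non-trivial and never -oo. *)
Record discrete_valuation (R : realType) (K : fieldType) := DiscreteValuation {
  dval :> K -> \bar int ;
  dval_eqoo : forall x, dval x = +oo%E <-> x = 0 ;
  dval_image : dval @` [set x | x != 0] = range EFin ;
  dvalM : forall x y, dval (x * y) = (dval x + dval y)%E ;
  dvalD : forall x y, (Order.min (dval x) (dval y) <= dval (x + y))%O ;
  dval_base : R ;
  dval_base_gt1 : 1 < dval_base
}.

(* |x| = base ^ (- val x), with |0| = base ^ (- oo) = 0 *)
Definition absval (R : realType) (K : fieldType) (v : discrete_valuation R K)
    (x : K) : R :=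
  if v x is m%:E then dval_base v ^ (- m) else 0.

Section Absval.
Variables (R : realType) (K : fieldType) (v : discrete_valuation R K).
Implicit Types x y z : K.

Lemma dval0 : v 0 = +oo%E.
Proof. exact/dval_eqoo. Qed.

Lemma dval_fin x : x != 0 -> exists m : int, v x = m%:E.
Proof.
move=> x0; have : (range EFin) (v x) by rewrite -(dval_image v); exists x.
by case=> m _ <-; exists m.
Qed.

Lemma absval0 : absval v 0 = 0.
Proof. by rewrite /absval dval0. Qed.

Lemma dval_base_gt0 : 0 < dval_base v.
Proof. exact: lt_trans ltr01 (dval_base_gt1 v). Qed.

Lemma absval_gt0 x : x != 0 -> 0 < absval v x.
Proof.
move=> /dval_fin[m vx]; rewrite /absval vx.
exact: exprz_gt0 dval_base_gt0.
Qed.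

Lemma absval_ge0 x : 0 <= absval v x.
Proof.
by have [->|/absval_gt0/ltW//] := eqVneq x 0; rewrite absval0.
Qed.

Lemma absval_eq0 x : absval v x = 0 -> x = 0.
Proof.
by have [//|/absval_gt0 + x0] := eqVneq x 0; rewrite x0 ltxx.
Qed.

Lemma dval1 : v 1 = 0%:E.
Proof.
have [m v1] := dval_fin (oner_neq0 K).
have := dvalM v 1 1; rewrite mulr1 v1 -EFinD => -[] /eqP.
by rewrite -subr_eq0 opprD addNKr oppr_eq0 => /eqP ->.
Qed.

Lemma dvalN x : v (- x) = v x.
Proof.
have N1 : (-1 : K) != 0 by rewrite oppr_eq0 oner_neq0.
have [m vN1] := dval_fin N1.
have := dvalM v (-1) (-1); rewrite mulrNN mulr1 dval1 vN1 -EFinD => -[] /esym/eqP.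
rewrite -mulr2n mulrn_eq0 /= => /eqP m0.
by rewrite -mulN1r dvalM vN1 m0 add0e.
Qed.

Lemma absvalN x : absval v (- x) = absval v x.
Proof. by rewrite /absval dvalN. Qed.

Lemma absvalD x y : absval v (x + y) <= Num.max (absval v x) (absval v y).
Proof.
have [->|x0] := eqVneq x 0; first by rewrite add0r le_max lexx orbT.
have [->|y0] := eqVneq y 0; first by rewrite addr0 le_max lexx.
have [->|xy0] := eqVneq (x + y) 0; first by rewrite absval0 le_max absval_ge0.
have [m vx] := dval_fin x0; have [k vy] := dval_fin y0.
have [l vxy] := dval_fin xy0.
have := dvalD v x y; rewrite /absval vx vy vxy.
by rewrite ge_min le_max !lee_fin !ler_eXz2l ?dval_base_gt1// !lerN2.
Qed.

End Absval.

(* K with the topology of the absolute value *)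
Definition valued (R : realType) (K : fieldType) (v : discrete_valuation R K)
  : Type := K.

Section Valued.
Variables (R : realType) (K : fieldType) (v : discrete_valuation R K).

Let dist (x y : valued v) : R := absval v ((x : K) - (y : K)).

Let distxx x : dist x x = 0.
Proof. by rewrite /dist subrr absval0. Qed.

Let dist_positivity x y : dist x y = 0 -> x = y.
Proof. by move=> /absval_eq0/eqP; rewrite subr_eq0 => /eqP. Qed.

Let dist_sym x y : dist x y = dist y x.
Proof. by rewrite /dist -absvalN opprB. Qed.

Let dist_triangle y x z : dist x z <= dist x y + dist y z.
Proof.
rewrite /dist -(subrKA (y : K)) (le_trans (absvalD _ _ _))//.
by rewrite ge_max lerDl lerDr !absval_ge0.
Qed.

HB.instance Definition _ := Choice.copy (valued v) K.
HB.instance Definition _ := isMetric.Build R (valued v)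
  distxx dist_positivity dist_sym dist_triangle.

End Valued.

(* The library's completeness axiom, without requiring a pointed structure. *)
Definition complete_space (T : uniformType) : Prop :=
  forall F : set_system T, ProperFilter F -> cauchy F -> exists l : T, F --> l.

Section Doo.
Variables (R : realType) (K : fieldType) (v : discrete_valuation R K).

Definition valring : set K := [set x | 0%E <= v x]%O.

Definition maxideal : set K := [set x | 0%E < v x]%O.

Definition uniformiser (pi : K) : Prop := v pi = 1%:E.

Definition residue_reps (S : set K) : Prop :=
  S `<=` valring /\
  forall x, valring x -> exists! s, S s /\ maxideal (x - s).

Variable n : nat.

Definition domain : set 'rV[K]_n := [set z | forall j, valring (z ord0 j)].

Definition polydisc (h : nat) (a : 'rV[K]_n) : set 'rV[K]_n :=
  [set z | forall j, h%:Z%:E <= v (z ord0 j - a ord0 j)]%O.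

(* Convergence in K^n, for the product topology *)
Definition cvg_rV (x : nat -> 'rV[K]_n) (y : 'rV[K]_n) : Prop :=
  (x : nat -> 'rV[valued v]_n) @ \oo --> (y : 'rV[valued v]_n).

(* A node (h, X) of the search tree is a cell X together with its level h. *)
Definition node : Type := (nat * set 'rV[K]_n)%type.

Definition cell (t : node) : Prop :=
  exists2 a, domain a & t.2 = polydisc t.1 a.

Definition root : node := (0%N, domain).

Definition children (t : node) : set node :=
  [set u | [/\ cell u, u.1 = t.1.+1 & u.2 `<=` t.2]].

(* The point of the cell of the form \sum_(j < h) c_j pi^j with c_j in S^n; it
   exists and is unique when S represents the residue classes and pi is a
   uniformiser, so the default 0 is immaterial. *)
Definition rep (S : set K) (pi : K) (t : node) : 'rV[K]_n :=
  xget 0 [set z | t.2 z /\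
    exists2 c : nat -> 'rV[K]_n, (forall j k, S (c j ord0 k)) &
      z = \sum_(j < t.1) pi ^+ j *: c j].

Definition leaf (T : set node) : set node :=
  [set t | T t /\ forall u, children t u -> ~ T u].

(* [x] is the sequence of iterates of a run of DOO maximising [f], with diameter
   bounds [delta]: [T N] is the tree after [N] epochs and [s N] the leaf expanded
   in the next epoch. Ties are broken arbitrarily. *)
Definition doo_iterates (S : set K) (pi : K) (f : 'rV[K]_n -> R)
    (delta : nat -> R) (x : nat -> 'rV[K]_n) : Prop :=
  let b t := f (rep S pi t) + delta t.1 in
  exists (T : nat -> set node) (s : nat -> node),
  [/\ T 0%N = [set root],
      forall N, leaf (T N) (s N) /\ forall t, leaf (T N) t -> b t <= b (s N),
      forall N, T N.+1 = T N `|` children (s N) &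
      forall N, exists2 t, T N t &
        (forall u, T N u -> f (rep S pi u) <= f (rep S pi t)) /\
        x N = rep S pi t].

Definition global_min (g : 'rV[K]_n -> R) (x : 'rV[K]_n) : Prop :=
  forall z, g x <= g z.

Definition abs_poly_sum (r : nat) (a : 'I_r -> R)
    (F : 'I_r -> mpoly.mpoly n K) (z : 'rV[K]_n) : R :=
  \sum_(i < r) a i * absval v (mpoly.meval (fun j => z ord0 j) (F i)).

Definition integral_mpoly (p : mpoly.mpoly n K) : Prop :=
  forall m, valring (mpoly.mcoeff m p).

End Doo.

(* The l^q norm on R^n, for 1 <= q <= +oo *)
Definition lqnorm (R : realType) (n : nat) (q : \bar R) (w : 'rV[R]_n) : R :=
  if q is r%:E then (\sum_(j < n) `|w ord0 j| `^ r) `^ r^-1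
  else \big[Num.max/0]_(j < n) `|w ord0 j|.

(* Main.v *)
(* The sum g is Lipschitz on O_K^n, in the sense that polynomials with integral
   coefficients preserve congruences modulo pi^h; hence b_{h,i} bounds f from
   above on the cell X_{h,i}. Some leaf always contains xstar, so the leaf (h,i)
   selected in an epoch has f(x_{h,i}) + delta(h) >= f(xstar). No node is
   selected twice and, O_K^n being compact, there are finitely many cells of
   each level, so the levels of the selected leaves are unbounded and
   f(x_N) -> f(xstar). Continuity of g identifies the limits of subsequences as
   minima, and compactness provides a convergent subsequence. *)
Require Import Defs.
From mathcomp Require Import all_boot all_order all_algebra.
From mathcomp Require Import all_classical all_reals all_analysis.
From mathcomp Require mpoly.

Set Implicit Arguments.
Unset Strict Implicit.
Unset Printing Implicit Defensive.

Import Order.TTheory GRing.Theory Num.Theory.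

Local Open Scope classical_set_scope.
Local Open Scope ring_scope.

(** * Valuation inequalities and the topology of [K] *)

Section Valuation.
Variables (R : realType) (K : fieldType) (v : discrete_valuation R K).
Implicit Types (x y z pi : K) (h : int).

Lemma dvalP x : v x = +oo%E \/ exists m : int, v x = m%:E.
Proof.
have [->|/(dval_fin v)] := eqVneq x 0; last by right.
by left; rewrite dval0.
Qed.

Lemma dval_geD h x y :
  (h%:E <= v x)%O -> (h%:E <= v y)%O -> (h%:E <= v (x + y))%O.
Proof.
by move=> hx hy; apply: le_trans (dvalD v x y); rewrite le_min hx hy.
Qed.

Lemma dval_geB h x y :
  (h%:E <= v x)%O -> (h%:E <= v y)%O -> (h%:E <= v (x - y))%O.
Proof. by move=> hx hy; rewrite dval_geD// dvalN. Qed.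

Lemma dval_geM h k x y :
  (h%:E <= v x)%O -> (k%:E <= v y)%O -> ((h + k)%:E <= v (x * y))%O.
Proof. by rewrite dvalM EFinD; exact: leeD. Qed.

Lemma dval_ge_sym h x y : (h%:E <= v (x - y))%O = (h%:E <= v (y - x))%O.
Proof. by rewrite -dvalN opprB. Qed.

Lemma dval_geM_valring h x y :
  (h%:E <= v x)%O -> valring v y -> (h%:E <= v (x * y))%O.
Proof. by move=> hx y0; rewrite -[h]addr0; exact: dval_geM. Qed.

Lemma valring0 : valring v 0.
Proof. by rewrite /valring/= dval0 leey. Qed.

Lemma valring1 : valring v 1.
Proof. by rewrite /valring/= dval1. Qed.

Lemma dval_gt0_ge1 x : (0%:E < v x)%O -> (1%:E <= v x)%O.
Proof. by have [->|[m ->]] := dvalP x; rewrite ?leey// lte_fin lee_fin. Qed.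

Lemma dvalX pi n : uniformiser v pi -> v (pi ^+ n) = n%:Z%:E.
Proof.
move=> pi1; elim: n => [|n IHn]; first by rewrite expr0 dval1.
by rewrite exprS dvalM IHn pi1 -EFinD -intS.
Qed.

Lemma uniformiser_neq0 pi : uniformiser v pi -> pi != 0.
Proof.
by move=> pi1; apply/eqP => p0; move: pi1; rewrite /uniformiser p0 dval0.
Qed.

Lemma dvalMXn pi n h x : uniformiser v pi ->
  ((n%:Z + h)%:E <= v (pi ^+ n * x))%O = (h%:E <= v x)%O.
Proof.
move=> pi1; rewrite dvalM dvalX//.
by have [->|[m ->]] := dvalP x; rewrite ?leey// -EFinD !lee_fin lerD2l.
Qed.

Lemma absval_le h x : (absval v x <= dval_base v ^ (- h)) = (h%:E <= v x)%O.
Proof.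
rewrite /absval; have [->|[m ->]] := dvalP x.
  by rewrite leey exprz_ge0// ltW// dval_base_gt0.
by rewrite lee_fin ler_eXz2l ?dval_base_gt1// lerN2.
Qed.

Lemma absval_uniformiser pi : uniformiser v pi -> absval v pi = (dval_base v)^-1.
Proof. by move=> pi1; rewrite /absval pi1 -exprN1. Qed.

Lemma absval_leX pi n x : uniformiser v pi ->
  (absval v x <= absval v pi ^+ n) = (n%:Z%:E <= v x)%O.
Proof.
by move=> pi1; rewrite (absval_uniformiser pi1) exprVn -absval_le exprnN.
Qed.

Lemma absval_uniformiser_cvg0 pi (e : R) : uniformiser v pi -> 0 < e ->
  exists n : nat, forall k : nat, (n <= k)%N -> absval v pi ^+ k < e.
Proof.
move=> pi1 e0.
have p1 : `|absval v pi| < 1.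
  rewrite absval_uniformiser// ger0_norm ?invr_ge0 ?ltW ?dval_base_gt0//.
  by rewrite invf_lt1 ?dval_base_gt0// dval_base_gt1.
have /cvgrPdist_lt/(_ e e0)[n _ +] := cvg_expr p1.
move=> ne; exists n => k /ne /=; rewrite sub0r normrN.
exact: le_lt_trans (ler_norm _).
Qed.

Lemma absval_lt_dval pi (e : R) : uniformiser v pi -> 0 < e ->
  exists n : nat, forall x, (n%:Z%:E <= v x)%O -> absval v x < e.
Proof.
move=> pi1 /(absval_uniformiser_cvg0 pi1)[n ne]; exists n => x nx.
by apply: le_lt_trans (ne n _); rewrite ?absval_leX.
Qed.

(** The ultrametric maximum is weakened to a sum, the form that adds up over the terms of
    [abs_poly_sum]. *)
Lemma absval_sub x y : absval v x <= absval v y + absval v (x - y).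
Proof.
rewrite -{1}(subrK y x) (le_trans (absvalD _ _ _))// ge_max lerDr lerDl.
by rewrite !absval_ge0.
Qed.

(** Powers of [absval v pi] tend to 0, so balls can be indexed by integer levels; topological
    questions then become inequalities of valuations. *)
Lemma nbhs_valuedP pi (p : valued v) (A : set (valued v)) : uniformiser v pi ->
  nbhs p A <->
  exists n : nat, forall z, (n%:Z%:E <= v (z - (p : K)))%O -> A z.
Proof.
move=> pi1; split => [/nbhs_ballP[e /= e0 eA]|[h hA]].
  have [h hx] := absval_lt_dval pi1 e0; exists h => z zp; apply: eA.
  by rewrite ballEmdist/=; apply: hx; rewrite dval_ge_sym.
apply/nbhs_ballP; exists (absval v pi ^+ h).
  by rewrite /= exprn_gt0// absval_gt0// uniformiser_neq0.
move=> z; rewrite ballEmdist/= => /ltW zp; apply: hA.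
by rewrite dval_ge_sym -(absval_leX _ _ pi1).
Qed.

End Valuation.

(** If [G] contained [A] while [F] contained the preimage of its complement, the finer filter [G]
    would contain two disjoint sets. *)
Lemma ultra_fmap (T U : Type) (f : T -> U) (F : set_system T) :
  UltraFilter F -> UltraFilter (f @ F).
Proof.
move=> FU; split=> [|G GF FG]; first exact: fmap_proper_filter.
apply/seteqP; split=> // A GA.
have [//|FnA] := in_ultra_setVsetC (f @^-1` A) FU.
have /filter_ex[z [] //] : G (A `&` ~` A) by apply: filterI => //; exact: FG.
Qed.

(** * Polydiscs, convergence in [K^n] and ultrafilter limits of integral elements *)

Section Polydisc.
Variables (R : realType) (K : fieldType) (v : discrete_valuation R K).
Variable n : nat.
Implicit Types (x y z a : 'rV[K]_n) (h : nat) (pi : K).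

Lemma polydisc_refl h a : polydisc v h a a.
Proof. by move=> j; rewrite subrr dval0 leey. Qed.

Lemma polydisc_sym h a z : polydisc v h a z -> polydisc v h z a.
Proof. by move=> az j; rewrite dval_ge_sym. Qed.

Lemma polydisc_trans h y x z : polydisc v h x y -> polydisc v h y z ->
  polydisc v h x z.
Proof.
by move=> xy yz j; rewrite -(subrKA (y ord0 j)); apply: dval_geD.
Qed.

Lemma polydisc_le h k a : (h <= k)%N -> polydisc v k a `<=` polydisc v h a.
Proof. by move=> hk z az j; apply: le_trans (az j); rewrite lee_fin lez_nat. Qed.

(** Congruence at level [h] is an equivalence relation, so every point of a polydisc is a centre of
    it. *)
Lemma polydisc_eq h a z : polydisc v h a z -> polydisc v h a = polydisc v h z.
Proof.
move=> az; apply/seteqP; split=> w; apply: polydisc_trans => //.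
exact: polydisc_sym.
Qed.

Lemma polydisc_domain h a : domain v a -> polydisc v h a `<=` @domain _ _ v n.
Proof.
move=> a0 z /(polydisc_le (leq0n h)) az j; rewrite -[z ord0 j](subrK (a ord0 j)).
by apply: dval_geD; [exact: az|exact: a0].
Qed.

Lemma domain_polydisc0 a : domain v a -> @domain _ _ v n = polydisc v 0 a.
Proof.
move=> a0; apply/seteqP; split=> [z z0 j|]; last exact: polydisc_domain.
by apply: dval_geB; [exact: z0|exact: a0].
Qed.

Lemma cvg_rV_polydisc pi (x : nat -> 'rV[K]_n) y : uniformiser v pi ->
  cvg_rV v x y <-> forall h, \forall k \near \oo, polydisc v h y (x k).
Proof.
move=> pi1; split=> [xy h|xy A [P yP PA]].
  apply: (xy (polydisc v h y)).
  exists (fun _ j => [set w : valued v | (h%:Z%:E <= v ((w : K) - y ord0 j))%O]).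
    by move=> i j; apply/(nbhs_valuedP _ _ pi1); exists h; rewrite [i]ord1.
  by move=> z Pz j; exact: Pz.
(* There are finitely many coordinates, so one index works for all of them. *)
have : \forall k \near \oo, forall j, P ord0 j (x k ord0 j).
  apply: filter_forall => j.
  have [h hP] := (nbhs_valuedP _ _ pi1).1 (yP ord0 j).
  by apply: filterS (xy h) => k; move/(_ j)/hP.
by apply: filterS => k Pk; apply: PA => i j; rewrite [i]ord1.
Qed.

(** A compact neighbourhood of 0 contains all elements of valuation at least some [m]. Scaling by
    [pi ^+ m] moves the family into it, and the limit found there is scaled back. *)
Lemma valring_ultra_cvg pi (I : Type) (F : set_system I) (w : I -> K) :
  uniformiser v pi -> locally_compact [set: valued v] -> UltraFilter F ->
  (forall i, valring v (w i)) ->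
  exists y : K, forall h, \forall i \near F, (h%:Z%:E <= v (w i - y))%O.
Proof.
move=> pi1 lc FU w0.
have := lc (0 : K) Logic.I => -[U]; rewrite /within/= => nU.
have {nU} : nbhs (0 : valued v) U by apply: filterS nU => z; exact.
move=> /(nbhs_valuedP _ _ pi1)[m mU] [+ _].
rewrite compact_ultra => /(_ _ (ultra_fmap (fun i => pi ^+ m * w i : valued v) FU)).
case.
  apply: (@filterE _ F) => i /=; apply: mU; rewrite subr0.
  by have := dvalMXn m 0 (w i) pi1; rewrite addr0 => ->; exact: w0.
move=> p [Up Fp]; exists (p / pi ^+ m) => h.
(* The level is [m + h] because dividing by [pi ^+ m] lowers valuations by [m]. *)
pose B := [set z : valued v | ((m + h)%N%:Z%:E <= v ((z : K) - (p : K)))%O].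
have pm0 : pi ^+ m != 0 by rewrite expf_neq0// (uniformiser_neq0 pi1).
have : nbhs p B by apply/(nbhs_valuedP _ _ pi1); exists (m + h)%N.
move=> /Fp; apply: (@filterS _ F) => i; rewrite /B/= PoszD.
rewrite -(dvalMXn m h (w i - _) pi1) mulrBr mulrCA divff ?mulr1//.
Qed.

End Polydisc.

(** * Compactness of the search domain and representatives of cells *)

Section Domain.
Variables (R : realType) (K : fieldType) (v : discrete_valuation R K).
Variable pi : K.
Hypothesis pi_unif : uniformiser v pi.

(** An ultrafilter finer than the eventual filter gives a limit in each coordinate. Its members
    contain arbitrarily large indices, which lets a subsequence be extracted. *)
Lemma domain_seq_compact n (x : nat -> 'rV[K]_n) :
  locally_compact [set: valued v] -> (forall k, domain v (x k)) ->
  exists (sigma : nat -> nat) (y : 'rV[K]_n),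
    {homo sigma : i j / (i < j)%N} /\ cvg_rV v (x \o sigma) y.
Proof.
move=> lc x0; have [F [FU ooF]] := ultraFilterLemma eventually_filter.
have /choice[y xy] (j : 'I_n) :=
  valring_ultra_cvg pi_unif lc FU (fun k => x0 k j).
have {xy} Fxy h : F (fun k => polydisc v h (\row_j y j) (x k)).
  have : \forall k \near F, forall j, (h%:Z%:E <= v (x k ord0 j - y j))%O.
    by apply: filter_forall => j; exact: xy.
  by apply: (@filterS _ F) => k xk j; rewrite mxE.
have /choice[next nextP] (hm : nat * nat) : exists k, (hm.2 <= k)%N /\
    polydisc v hm.1 (\row_j y j) (x k).
  have Fm : F [set k | (hm.2 <= k)%N] by apply: ooF; exists hm.2.
  by have [k [mk xk]] := filter_ex (filterI Fm (Fxy hm.1)); exists k.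
(* [sigma k] lies beyond its predecessor, with [x (sigma k)] in the polydisc of level [k] about the
   limit. *)
pose fix sigma k := if k is k'.+1 then next (k, (sigma k').+1) else next (0, 0)%N.
exists sigma, (\row_j y j); split.
  apply: homo_ltn => [|k]; first exact: ltn_trans.
  exact: (nextP (k.+1, (sigma k).+1)).1.
apply/(cvg_rV_polydisc _ _ pi_unif) => h; exists h => // k hk.
apply: (polydisc_le hk) => /=.
by case: k {hk} => [|k]; [exact: (nextP (0, 0)%N).2|exact: (nextP (_, _)).2].
Qed.

Lemma cvg_rV_domain n (x : nat -> 'rV[K]_n) y :
  (forall k, domain v (x k)) -> cvg_rV v x y -> domain v y.
Proof.
move=> x0 /(cvg_rV_polydisc _ _ pi_unif)/(_ 0%N)[k _ /(_ k (leqnn k)) xk].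
by apply: polydisc_domain (polydisc_sym xk); exact: x0.
Qed.

Variable S : set K.
Hypothesis S_reps : residue_reps v S.

(** Expansion in base [pi]: [d] gives the digits in [S] and [w] the remainders of repeated division
    by [pi]. *)
Lemma digit_expansion : exists d w : K -> nat -> K,
  [/\ forall a j, S (d a j),
      forall a j, valring v a -> valring v (w a j) &
      forall a h, a = \sum_(j < h) pi ^+ j * d a j + pi ^+ h * w a h].
Proof.
have pi0 := uniformiser_neq0 pi_unif; have [SO Sres] := S_reps.
(* Outside the valuation ring [s] defaults to a representative of 0, so that digits always lie in
   [S]. *)
have /choice[s sP] (a : K) : exists s, S s /\ (valring v a -> maxideal v (a - s)).
  have [/Sres[s [[Ss as_] _]]|a0] := pselect (valring v a); first by exists s.
  by have [s [[Ss _] _]] := Sres _ (valring0 v); exists s; split=> // /a0.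
pose w a j := iter j (fun b => (b - s b) / pi) a.
exists (fun a j => s (w a j)), w; split=> [a j|a j a0|a h].
- exact: (sP _).1.
- elim: j => [//|j IHj]; have /dval_gt0_ge1 := (sP _).2 IHj.
  rewrite /valring/= -(dvalMXn 1 0 _ pi_unif) addr0 expr1.
  by rewrite mulrC divfK.
- elim: h => [|h IHh]; first by rewrite big_ord0 expr0 mul1r add0r.
  rewrite [LHS]IHh big_ord_recr/= -addrA; congr (_ + _).
  by rewrite exprSr -mulrA [pi * _]mulrC divfK// -mulrDr subrKC.
Qed.

(** Truncating the expansions of the centre's coordinates after [h] digits leaves an error of
    [pi ^+ h] times an integral remainder. This witness keeps [xget] from returning its default. *)
Lemma rep_cell n (t : node K n) : cell v t -> t.2 (rep S pi t).
Proof.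
case: t => h X [a /= a0 ->]; rewrite /rep/=.
have [d [w [Sd w0 dw]]] := digit_expansion.
case: xgetP => [z _ []//|/(_ (\sum_(j < h) pi ^+ j *: \row_k d (a ord0 k) j))].
case; split; last first.
  by exists (fun j => \row_k d (a ord0 k) j) => // j k; rewrite mxE.
move=> k; rewrite dval_ge_sym summxE [X in X - _](dw _ h).
under [X in _ - X]eq_bigr do rewrite !mxE.
rewrite addrC addrA addNr add0r; have := dvalMXn h 0 (w (a ord0 k) h) pi_unif.
by rewrite addr0 => ->; apply: w0; exact: a0.
Qed.

Lemma cell_domain n (t : node K n) : cell v t -> t.2 `<=` @domain _ _ v n.
Proof. by case: t => h X [a /= a0 ->]; exact: polydisc_domain. Qed.

Lemma cell_polydisc n (t : node K n) z : cell v t -> t.2 z ->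
  t.2 = polydisc v t.1 z.
Proof. by case: t => h X [a /= a0 ->] /polydisc_eq. Qed.

End Domain.

(** * Lipschitz estimate for [abs_poly_sum] on integral points *)

Section Lipschitz.
Variables (R : realType) (K : fieldType) (v : discrete_valuation R K).

(** Integrality of both sides is bundled in so that the relation is stable under products and
    [big_ind2] applies to it. *)
Definition valring_cong (h : nat) (x y : K) : Prop :=
  [/\ valring v x, valring v y & (h%:Z%:E <= v (x - y))%O].

Lemma valring_cong_refl h x : valring v x -> valring_cong h x x.
Proof. by move=> x0; split=> //; rewrite subrr dval0 leey. Qed.

Lemma valring_congD h x1 y1 x2 y2 :
  valring_cong h x1 y1 -> valring_cong h x2 y2 ->
  valring_cong h (x1 + x2) (y1 + y2).
Proof.
move=> [x10 y10 xy1] [x20 y20 xy2]; split; [exact: dval_geD|exact: dval_geD|].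
by rewrite opprD addrACA; exact: dval_geD.
Qed.

Lemma valring_congM h x1 y1 x2 y2 :
  valring_cong h x1 y1 -> valring_cong h x2 y2 ->
  valring_cong h (x1 * x2) (y1 * y2).
Proof.
move=> [x10 y10 xy1] [x20 y20 xy2]; split; [exact: dval_geM_valring..|].
rewrite -(subrKA (y1 * x2)) -mulrBl -mulrBr; apply: dval_geD.
  exact: dval_geM_valring.
by rewrite mulrC; exact: dval_geM_valring.
Qed.

Lemma valring_congX h x y k : valring_cong h x y ->
  valring_cong h (x ^+ k) (y ^+ k).
Proof.
move=> xy; elim: k => [|k IHk]; last by rewrite !exprS; exact: valring_congM.
by rewrite !expr0; exact/valring_cong_refl/valring1.
Qed.

Lemma meval_cong n h (p : mpoly.mpoly n K) (x y : 'I_n -> K) :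
  integral_mpoly v p -> (forall j, valring_cong h (x j) (y j)) ->
  valring_cong h (mpoly.meval x p) (mpoly.meval y p).
Proof.
move=> p0 xy; rewrite !mpoly.mevalE; apply: (big_ind2 (valring_cong h)).
- exact/valring_cong_refl/valring0.
- by move=> *; exact: valring_congD.
- move=> m _; apply: valring_congM; first exact/valring_cong_refl/p0.
  apply: (big_ind2 (valring_cong h)); first exact/valring_cong_refl/valring1.
    by move=> *; exact: valring_congM.
  by move=> j _; exact: valring_congX.
Qed.

(** Values of [F i] at congruent integral points are congruent, so the [i]-th term grows by at most
    [a i * absval v pi ^+ h]. *)
Lemma abs_poly_sum_lipschitz pi n r (a : 'I_r -> R) (F : 'I_r -> mpoly.mpoly n K)
    h (x y : 'rV[K]_n) :
  uniformiser v pi -> (forall i, 0 <= a i) ->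
  (forall i, integral_mpoly v (F i)) ->
  domain v x -> domain v y -> polydisc v h x y ->
  abs_poly_sum v a F y <=
    abs_poly_sum v a F x + (\sum_(i < r) a i) * absval v pi ^+ h.
Proof.
move=> pi1 a0 F0 x0 y0 xy; rewrite mulr_suml -big_split/=.
apply: ler_sum => i _; rewrite -mulrDr ler_wpM2l//.
pose Fx := mpoly.meval (fun j => x ord0 j) (F i); rewrite -/Fx.
apply: le_trans (absval_sub _ _ Fx) _; rewrite lerD2l (absval_leX _ _ pi1).
have [] // : valring_cong h (mpoly.meval (fun j => y ord0 j) (F i)) Fx.
exact: meval_cong.
Qed.

End Lipschitz.

(** * The norm factor in the bound [delta] *)

Lemma lqnorm_const1_ge1 (R : realType) n (q : \bar R) : (1 <= q)%E ->
  1 <= lqnorm q (const_mx 1 : 'rV[R]_n.+1).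
Proof.
case: q => [q| |]//; rewrite /lqnorm ?lee_fin => q1.
  under eq_bigr do rewrite mxE normr1 powR1.
  rewrite sumr_const card_ord.
  apply: (@le_trans _ _ (1 `^ q^-1)); first by rewrite powR1.
  by rewrite ge0_ler_powR ?nnegrE ?invr_ge0 ?(le_trans ler01)// ler1n.
by apply: le_trans (le_bigmax _ _ ord0); rewrite mxE normr1.
Qed.

Lemma lqnorm_ge0 (R : realType) n (q : \bar R) (w : 'rV[R]_n) : 0 <= lqnorm q w.
Proof.
have bigmax_ge0 : 0 <= \big[Num.max/0]_(j < n) `|w ord0 j| by exact: bigmax_ge_id.
by case: q => [q| |]//; exact: powR_ge0.
Qed.

(** In positive dimension the norm factor is at least 1 and only weakens the Lipschitz bound. In
    dimension 0 the norm is 0, but there [x] and [y] coincide. *)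
Lemma abs_poly_sum_le_lqnorm (R : realType) (K : fieldType)
    (v : discrete_valuation R K) pi n r (a : 'I_r -> R)
    (F : 'I_r -> mpoly.mpoly n K) h (x y : 'rV[K]_n) (q : \bar R) :
  uniformiser v pi -> (forall i, 0 <= a i) ->
  (forall i, integral_mpoly v (F i)) ->
  (1 <= q)%E -> domain v x -> domain v y -> polydisc v h x y ->
  abs_poly_sum v a F y <= abs_poly_sum v a F x +
    (\sum_(i < r) a i) * absval v pi ^+ h * lqnorm q (const_mx 1 : 'rV[R]_n).
Proof.
move=> pi1 a0 F0 q1 x0 y0 xy.
have Lh0 : 0 <= (\sum_(i < r) a i) * absval v pi ^+ h.
  by rewrite mulr_ge0 ?sumr_ge0// exprn_ge0// absval_ge0.
case: n => [|n] in F x y F0 x0 y0 xy *.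
  by rewrite [y]thinmx0 [x]thinmx0 lerDl mulr_ge0// lqnorm_ge0.
apply: le_trans (abs_poly_sum_lipschitz pi1 a0 F0 x0 y0 xy) _.
by rewrite lerD2l ler_peMr// lqnorm_const1_ge1.
Qed.

(** * Invariants of the search tree *)

Section Doo.
Variables (R : realType) (K : fieldType) (v : discrete_valuation R K).
Variables (pi : K) (pi_unif : uniformiser v pi).
Variables (S : set K) (S_reps : residue_reps v S).
Variable n : nat.
Implicit Types (t u : node K n) (z : 'rV[K]_n).

Lemma cell_root : cell v (Defs.root v n).
Proof.
have domain0 : domain v (0 : 'rV[K]_n) by move=> j; rewrite mxE; exact: valring0.
by exists 0 => //=; exact: domain_polydisc0.
Qed.

(** A child contains its own centre, and a cell is determined by its level and any one of its
    points. *)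
Lemma cell_parent_uniq t t' u : cell v t -> cell v t' ->
  children v t u -> children v t' u -> t = t'.
Proof.
move=> ct ct' [[a a0 ua] ut sut] [_ ut' sut'].
have ua' : u.2 a by rewrite ua; exact: polydisc_refl.
have tt' : t.1 = t'.1 by move: ut; rewrite ut' => -[].
apply: injective_projections => //.
by rewrite (cell_polydisc ct (sut _ ua')) tt' -(cell_polydisc ct' (sut' _ ua')).
Qed.

Lemma cell_child t z : cell v t -> t.2 z ->
  children v t (t.1.+1, polydisc v t.1.+1 z).
Proof.
move=> ct tz; split=> //=; first by exists z => //; exact: cell_domain tz.
by rewrite (cell_polydisc ct tz); exact: polydisc_le.
Qed.

Variables (T : nat -> set (node K n)) (s : nat -> node K n).
Hypothesis T0 : T 0%N = [set Defs.root v n].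
Hypothesis s_leaf : forall N, leaf v (T N) (s N).
Hypothesis TS : forall N, T N.+1 = T N `|` children v (s N).

Lemma tree_cell N t : T N t -> cell v t.
Proof.
elim: N t => [|N IHN] t; first by rewrite T0 => ->; exact: cell_root.
by rewrite TS => -[/IHN//|[]].
Qed.

Lemma tree_mono N M : (N <= M)%N -> T N `<=` T M.
Proof.
move=> /subnKC <-; elim: (M - N)%N => [|k IHk]; first by rewrite addn0.
by rewrite addnS TS => t /IHk; left.
Qed.

Lemma selected_cell N : cell v (s N).
Proof. exact: tree_cell (s_leaf N).1. Qed.

(** A node other than the root enters the tree as a child of the selected leaf, which is then its
    only parent; the root has level 0 and is nobody's child. *)
Lemma tree_parent N t u : T N u -> cell v t -> children v t u -> T N t.
Proof.
elim: N => [|N IHN] Tu ct tu.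
  by move: Tu tu; rewrite T0 => -> [].
move: Tu; rewrite TS => -[Tu|su]; left; first exact: IHN.
by rewrite (cell_parent_uniq ct (selected_cell N) tu su); exact: (s_leaf N).1.
Qed.

(** A leaf around [z] stays a leaf until it is selected; then its child around [z] takes over. *)
Lemma leaf_containing N z : domain v z -> exists t, leaf v (T N) t /\ t.2 z.
Proof.
move=> z0; elim: N => [|N [t [[Tt tleaf] tz]]].
  exists (Defs.root v n); split=> //; rewrite T0; split=> // u [_ u1 _] uroot.
  by move: u1; rewrite uroot.
have ct := tree_cell Tt; have cs := selected_cell N.
have [ts|nts] := pselect (t = s N); last first.
  exists t; rewrite TS; split=> //; split=> [|u tu]; first by left.
  by case=> [/(tleaf _ tu)//|/(cell_parent_uniq ct cs tu)].
have tc := cell_child ct tz; set c := (_, _) in tc.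
exists c; split; last exact: polydisc_refl.
split=> [|u cu]; first by rewrite TS -ts; right.
(* A child [u] of [c] in the old tree would put [c] there too, although [t] was a leaf; a new node
   [u] would have the same level as [c]. *)
rewrite TS -ts => -[Tu|[_ u1 _]].
  by apply: (tleaf c tc); apply: tree_parent cu => //; case: tc.
by case: cu => _; rewrite u1 => /eqP; rewrite eqn_leq ltnn andbF.
Qed.

(** Cells are nonempty, so an expanded node has a child in all later trees and is never a leaf
    again. *)
Lemma selected_inj : injective s.
Proof.
suff s_neq N M : (N < M)%N -> s N <> s M.
  move=> N M sNM; have [NM|MN|//] := ltngtP N M.
    by have := s_neq _ _ NM; rewrite sNM.
  by have := s_neq _ _ MN; rewrite sNM.
move=> NM sNM; have [_] := s_leaf M; rewrite -sNM.
have [z sz] : exists z, (s N).2 z.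
  have [a _ ->] := selected_cell N; exists a; exact: polydisc_refl.
have sc := cell_child (selected_cell N) sz.
by move=> /(_ _ sc); apply; apply: (tree_mono NM); rewrite TS; right.
Qed.

(* By compactness, infinitely many cells of level at most [h] would have
   representatives in a common polydisc of level [h], hence be determined by
   their levels. *)
Lemma selected_level_unbounded : locally_compact [set: valued v] ->
  forall h, exists N, (h < (s N).1)%N.
Proof.
move=> lc h; apply: contrapT => hs.
have {hs} sh N : ((s N).1 <= h)%N.
  by rewrite leqNgt; apply/negP => hN; apply: hs; exists N.
have s_rep N := rep_cell pi_unif S_reps (selected_cell N).
have [k|sigma [y [sigma_lt]]] :=
  domain_seq_compact (x := fun N => rep S pi (s N)) pi_unif lc.
  by apply: cell_domain (s_rep k); exact: selected_cell.
move=> /(cvg_rV_polydisc _ _ pi_unif)/(_ h)[k0 _ yk].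
(* Pigeonhole: [h + 2] selected nodes from the tail share the [h + 1] levels up to [h]. *)
pose level (i : 'I_h.+2) : 'I_h.+1 := inord (s (sigma (k0 + i)%N)).1.
suff /leq_card : injective level by rewrite !card_ord ltnn.
have s_polydisc k : (k0 <= k)%N ->
    (s (sigma k)).2 = polydisc v (s (sigma k)).1 y.
  move=> /yk/= /(polydisc_le (sh (sigma k))) ky.
  by rewrite (cell_polydisc (selected_cell _) (s_rep _)) (polydisc_eq ky).
move=> i j /(congr1 val); rewrite /= !inordK ?ltnS// => ij.
have : s (sigma (k0 + i)%N) = s (sigma (k0 + j)%N).
  by apply: injective_projections; rewrite // !s_polydisc ?leq_addr// ij.
have sigma_inj : injective sigma.
  move=> k l kl.
  by have [/sigma_lt|/sigma_lt|//] := ltngtP k l; rewrite kl ltnn.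
by move=> /selected_inj/sigma_inj/addnI/val_inj.
Qed.

End Doo.

(** * Near-optimality of the iterates and convergence to minima *)

(** The error is [delta] at the level [l] of some deep selected leaf; [delta] is arbitrary here, so
    it cannot be compared with [delta h]. *)
Lemma doo_near_optimal (R : realType) (K : fieldType)
    (v : discrete_valuation R K) (pi : K) (S : set K) (n : nat)
    (f : 'rV[K]_n -> R) (delta : nat -> R) (x : nat -> 'rV[K]_n) :
  uniformiser v pi -> residue_reps v S -> locally_compact [set: valued v] ->
  doo_iterates v S pi f delta x ->
  (forall t z, cell v t -> t.2 z -> f z <= f (rep S pi t) + delta t.1) ->
  (forall N, domain v (x N)) /\
  forall z h, domain v z -> exists l, (h < l)%N /\
    \forall N \near \oo, f z <= f (x N) + delta l.
Proof.
move=> pi1 S_reps lc [T [s [T0 sP TS xP]]] fdelta.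
have s_leaf N := (sP N).1.
split=> [N|z h z0].
  have [t /(tree_cell T0 TS) ct [_ ->]] := xP N.
  exact: cell_domain (rep_cell pi1 S_reps ct).
have [N hN] := selected_level_unbounded pi1 S_reps T0 s_leaf TS lc h.
exists (s N).1; split=> //; exists N => // M NM.
(* The leaf [t] around [z] bounds [f z] by its own upper bound, hence by that of [s N], which is a
   node of every later tree. *)
have [t [tleaf tz]] := leaf_containing T0 s_leaf TS N z0.
apply: le_trans (fdelta t z (tree_cell T0 TS tleaf.1) tz) _.
apply: le_trans ((sP N).2 t tleaf) _; rewrite lerD2r.
have [u _ [umax ->]] := xP M; apply: umax.
by apply: (tree_mono TS NM); exact: (s_leaf N).1.
Qed.

Theorem theorem83 (R : realType) (K : fieldType) (v : discrete_valuation R K)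
    (K_complete : complete_space (valued v))
    (K_lc : locally_compact [set: valued v])
    (pi : K) (pi_unif : uniformiser v pi)
    (S : set K) (S_reps : residue_reps v S)
    (n r : nat) (a : 'I_r -> R) (a_gt0 : forall i, 0 < a i)
    (F : 'I_r -> mpoly.mpoly n K) (F_int : forall i, integral_mpoly v (F i))
    (q : \bar R) (q_ge1 : (1%:E <= q)%E) :
  let g : 'rV[K]_n -> R := abs_poly_sum v a F in
  let f : 'rV[K]_n -> R := fun z => - g z in
  let L : R := \sum_(i < r) a i in
  let delta : nat -> R :=
    fun h => L * absval v pi ^+ h * lqnorm q (const_mx 1 : 'rV[R]_n) in
  forall xstar : 'rV[K]_n, domain v xstar -> global_min g xstar ->
  forall x : nat -> 'rV[K]_n, doo_iterates v S pi f delta x ->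
  (exists sigma : nat -> nat, exists y : 'rV[K]_n,
     [/\ {homo sigma : i j / (i < j)%N}, cvg_rV v (x \o sigma) y
       & global_min g y]) /\
  (forall (sigma : nat -> nat) (y : 'rV[K]_n),
     {homo sigma : i j / (i < j)%N} -> cvg_rV v (x \o sigma) y ->
     global_min g y).
Proof.
move=> g f L delta xstar xstar0 xstar_min x x_doo.
have a_ge0 i : 0 <= a i by exact: ltW.
have L_ge0 : 0 <= L by exact: sumr_ge0.
have g_lip h z w : domain v z -> domain v w -> polydisc v h z w ->
    g w <= g z + delta h by exact: abs_poly_sum_le_lqnorm.
have f_delta t z : cell v t -> t.2 z -> f z <= f (rep S pi t) + delta t.1.
  move=> ct tz; have rept := rep_cell pi_unif S_reps ct.
  rewrite -lerBlDr -opprD lerN2; apply: g_lip; [exact: cell_domain tz|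
    exact: cell_domain rept|by rewrite -(cell_polydisc ct tz)].
have [x_domain x_opt] := doo_near_optimal pi_unif S_reps K_lc x_doo f_delta.
(* Stated for all later levels, since [x_opt] gives a bound at an unspecified level [l > h]. *)
have delta_small e : 0 < e -> exists h, forall l, (h <= l)%N -> delta l < e.
  move=> e0; set C := L * lqnorm q (const_mx 1 : 'rV[R]_n).
  have C0 : 0 <= C by rewrite mulr_ge0 ?sumr_ge0 ?lqnorm_ge0.
  (* [C] may be 0, as for an empty sum, hence the division by [C + 1]. *)
  have C1 : 0 < C + 1 by rewrite ltr_wpDl.
  have [h he] := absval_uniformiser_cvg0 pi_unif (divr_gt0 e0 C1).
  exists h => l /he; rewrite ltr_pdivlMr// => le_; apply: le_lt_trans le_.
  rewrite /delta mulrAC -/C mulrC ler_wpM2l ?exprn_ge0 ?absval_ge0//.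
  by rewrite lerDl.
have limit_min (sigma : nat -> nat) y : {homo sigma : i j / (i < j)%N} ->
    cvg_rV v (x \o sigma) y -> global_min g y.
  (* [xstar] is minimal on all of [K^n], so comparing [y] with it also covers [z] outside the
     domain. *)
  move=> sigma_lt xy z; apply: le_trans (xstar_min z).
  have y_domain : domain v y.
    by apply: (cvg_rV_domain pi_unif _ xy) => k; exact: x_domain.
  apply/ler_addgt0Pr => e e0.
  (* One half of [e] pays for passing from [y] to a late iterate in its polydisc of level [h], the
     other for passing from that iterate to [xstar]. *)
  have [h delta_lt] := delta_small _ (divr_gt0 e0 (ltr0n _ 2)).
  have [l [hl [N _ xN]]] := x_opt xstar h xstar0.
  have [k0 _ yk] := (cvg_rV_polydisc _ _ pi_unif).1 xy h.
  pose k := maxn N k0.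
  have sigma_ge i : (i <= sigma i)%N.
    by elim: i => // i IHi; exact: leq_ltn_trans IHi (sigma_lt _ _ (ltnSn i)).
  have Nk : (N <= sigma k)%N := leq_trans (leq_maxl N k0) (sigma_ge k).
  have := xN _ Nk; rewrite -lerBlDr -opprD lerN2 => gx.
  have yxk := polydisc_sym (yk k (leq_maxr _ _)).
  have := g_lip _ _ _ (x_domain (sigma k)) y_domain yxk.
  move=> /le_trans; apply; have -> : e = e / 2 + e / 2 by rewrite -splitr.
  rewrite addrA lerD//; last exact: ltW (delta_lt _ (leqnn h)).
  by rewrite (le_trans gx)// lerD2l ltW// delta_lt// ltnW.
split=> //; have [sigma [y [sigma_lt xy]]] :=
  domain_seq_compact pi_unif K_lc x_domain.
by exists sigma, y; split=> //; exact: limit_min xy.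
Qed.
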